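(* Let $k$ be an algebraically closed field of characteristic $p>0$, let $f=\sum_{i=0}^n a_i x^i z^{n-i}$ be the binary form of degree $n$ with indeterminate coefficients $a_0,\dots,a_n$, and let $$\mathcal{Q}=\sum_{i=0}^{m_0}\mathcal{Q}_i x^i z^{m_0-i},\qquad \mathcal{Q}_i\in k[a_0,\dots,a_n],$$ be a covariant of $f$ (under the action of $\mathrm{SL}_2(k)$) of order $m_0$, degree $d_0$ and weight $\omega_0$. Let $l$ be a positive integer with $l\le m_0/2$ and $l<p$. Then $$C=\frac{1}{z^{l}}\,\frac{\partial^{l}\mathcal{Q}}{\partial x^{l}}$$ is a covariant of $f$ (under the action of $\mathrm{SL}_2(k)$) if and only if $m_0-l+1\equiv 0 \pmod p$. Moreover, when $C$ is a non-zero covariant, its order is $m_0-2l$ and its degree is $d_0$.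
   Context: For $M\in\mathrm{SL}_2(k)$ define $a'=(a'_0,\dots,a'_n)$ (linear forms in $a=(a_0,\dots,a_n)$ depending on $M$) by $f(M\cdot(x,z))=\sum_{i=0}^n a'_i x^i z^{n-i}$, where $M$ acts on $(x,z)$ as on a column vector. Let $k[a_0,\dots,a_n]_d$ denote the space of homogeneous polynomials of degree $d$. A polynomial $C=\sum_{i=0}^m C_i x^i z^{m-i}$ with $C_i\in k[a_0,\dots,a_n]_d$, homogeneous of degree $m$ in $(x,z)$, is a covariant of $f$ under the action of $\mathrm{SL}_2(k)$, of degree $d$ and order $m$, if $C(a',M^{-1}\cdot(x,z))=C(a,(x,z))$ for all $M\in\mathrm{SL}_2(k)$. The expression $\frac{1}{z^l}\frac{\partial^l\mathcal{Q}}{\partial x^l}$ lies a priori in $k[a_0,\dots,a_n][x,z,z^{-1}]$; saying that it is a covariant includes that it is a polynomial. The weight of a monomial $a_0^{\rho_0}\cdots a_n^{\rho_n}$ is $\sum_i i\rho_i$. A covariant has coefficients $C_i$ whose monomials all have weight $w+i$, for an integer $w$ with $nd-2w=m$; this $w$ is called the weight of the covariant.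
   Formalization: The ''only if'' direction is stated for C ≠ 0 only, since zero counts as a covariant and it then fails: for p = 3, n = 2, Q = f^3, l = 2 one gets C = 0 although m_0 - l + 1 = 5 is not 0 mod 3. *)

(* Defs.v *)
From mathcomp Require Import all_boot all_order all_algebra.
From mathcomp Require Export mpoly.

Set Implicit Arguments.
Unset Strict Implicit.
Unset Printing Implicit Defensive.

Import GRing.Theory.
Local Open Scope ring_scope.

(* The coefficient ring is k[a_0, ..., a_n], with a_i = 'X_i in n.+1           *)
(* indeterminates; forms in (x, z) are polynomials in two further              *)
(* indeterminates over it, x being number 0 and z number 1.                    *)
Notation coef_ring k n := {mpoly k[n.+1]}.
Notation xz_ring k n := {mpoly (coef_ring k n)[2]}.

Definition ix : 'I_2 := ord0.
Definition iz : 'I_2 := ord_max.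

Definition mon_xz (i j : nat) : 'X_{1..2} := (U_(ix) *+ i + U_(iz) *+ j)%MM.

Definition generic_form (k : fieldType) (n : nat) : xz_ring k n :=
  \sum_(i < n.+1) 'X_i *: 'X_[mon_xz i (n - i)].

(* The two entries of the column vector M (x, z)^T. *)
Definition act_xz (k : fieldType) (n : nat) (M : 'M[k]_2) :
    2.-tuple (xz_ring k n) :=
  [tuple \sum_(j < 2) (M i j)%:MP *: 'X_j | i < 2].

(* a'_i is read off as the coefficient of x^i z^(n-i) in f(M (x, z)). *)
Definition act_coef (k : fieldType) (n : nat) (M : 'M[k]_2) :
    n.+1.-tuple (coef_ring k n) :=
  [tuple (generic_form k n \mPo act_xz n M)@_(mon_xz i (n - i)) | i < n.+1].

(* C(a', M^-1 (x, z)) *)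
Definition act_form (k : fieldType) (n : nat) (M : 'M[k]_2) (C : xz_ring k n) :
    xz_ring k n :=
  map_mpoly (comp_mpoly (act_coef n M)) C \mPo act_xz n (invmx M).

(* 0 is homogeneous of every degree, hence a covariant of every degree and     *)
(* order.                                                                      *)
Definition is_covariant (k : fieldType) (n d m : nat) (C : xz_ring k n) :
    Prop :=
  [/\ C \is m.-homog,
      forall u : 'X_{1..2}, C@_u \is d.-homog
    & forall M : 'M[k]_2, \det M = 1 -> act_form M C = C].

(* Not multinomials' mnmwgt, which weights the i-th exponent by i.+1. *)
Definition mon_weight (n : nat) (r : 'X_{1..n.+1}) : nat :=
  (\sum_(i < n.+1) i * r i)%N.

Definition has_weight (k : fieldType) (n d m : nat) (w : int)
    (C : xz_ring k n) : Prop :=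
  (n * d)%:Z - 2 * w = m%:Z /\
  forall (i : nat) (r : 'X_{1..n.+1}), (i <= m)%N ->
    r \in msupp C@_(mon_xz i (m - i)) -> (mon_weight r)%:Z = w + i%:Z.

(* k[a][x, z, z^-1] is viewed inside the fraction field of k[a][x, z]; being a *)
(* covariant includes being a polynomial.                                      *)
Definition frac_covariant_of (k : fieldType) (n d m : nat)
    (C : {fraction (xz_ring k n)}) : Prop :=
  exists2 P : xz_ring k n, C = tofrac P & is_covariant d m P.

Definition frac_covariant (k : fieldType) (n : nat)
    (C : {fraction (xz_ring k n)}) : Prop :=
  exists d m : nat, frac_covariant_of d m C.

(* Main.v *)
(* Write [X, Z] for the entries of [M (x, z)] and [D] for the derivation
   [M_00 d/dX + M_10 d/dZ], which is [d/dx] in the new coordinates; moreover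
   [z = M_00 Z - M_10 X].  Hence, if [Q] is a covariant and
   [z^l C = d^l Q / dx^l] with [C] a polynomial, then [C] is invariant under [M]
   if and only if
     [Z^l D^l Q = (M_00 Z - M_10 X)^l d^l Q / dX^l].
   If [m0 - l + 1 = 0] in [k], Euler's identity gives [Z D = (M_00 Z - M_10 X) d/dX]
   on forms of degree [m0 - l + 1], and the identity follows by induction on [l];
   for [(M_00, M_10) = (0, -1)] it shows that [z^l] divides [d^l Q / dx^l].
   Conversely, take [(M_00, M_10) = (1, t)]: comparing the coefficients of [t]
   gives [l (X d/dX + Z d/dZ) d^(l-1) Q / dX^(l-1) = 0], that is
   [l (m0 - l + 1) d^(l-1) Q / dX^(l-1) = 0]. *)

Require Import Defs.
From mathcomp Require Import all_boot all_order all_algebra.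
From mathcomp Require Import ring zify.

Set Implicit Arguments.
Unset Strict Implicit.
Unset Printing Implicit Defensive.

Import GRing.Theory.
Local Open Scope ring_scope.

(** * Derivatives, substitution and homogeneity of multivariate polynomials *)

Lemma mpoly_gen_ind (n : nat) (R : nzRingType) (P : {mpoly R[n]} -> Prop) :
    (forall c, P c%:MP) -> (forall i, P 'X_i) ->
    (forall p q, P p -> P q -> P (p + q)) ->
    (forall p q, P p -> P q -> P (p * q)) ->
  forall p, P p.
Proof.
move=> PC PX PD PM; elim/mpolyind => [|c m p _ _ Pp].
  by rewrite -mpolyC0; exact: PC.
apply: PD => //; rewrite -mul_mpolyC; apply: (PM) => //.
rewrite mpolyXE_id; apply: (big_ind P) => // [|i _]; first exact: (PC 1).
elim: (m i) => [|e IHe]; first exact: (PC 1).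
by rewrite exprS; apply: PM.
Qed.

Lemma mderivXU (n : nat) (R : nzRingType) (i j : 'I_n) :
  ('X_j : {mpoly R[n]})^`M(i) = (j == i)%:R.
Proof.
rewrite mderivX mnm1E; have [->|_] := eqVneq j i; last by rewrite scale0r.
have -> : (U_(i) - U_(i) = 0 :> 'X_{1..n})%MM.
  by apply/mnmP => s; rewrite mnmBE mnm0E subnn.
by rewrite mpolyX0 scale1r.
Qed.

Lemma mderiv_comp_mpoly (n m : nat) (R : comNzRingType)
    (lq : n.-tuple {mpoly R[m]}) (i : 'I_m) (p : {mpoly R[n]}) :
  (p \mPo lq)^`M(i) = \sum_(j < n) (p^`M(j) \mPo lq) * (tnth lq j)^`M(i).
Proof.
elim/mpoly_gen_ind: p => [c|j|p q IHp IHq|p q IHp IHq].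
- rewrite comp_mpolyC mderivC big1 // => j _.
  by rewrite mderivC comp_mpoly0 mul0r.
- rewrite comp_mpolyXU -tnth_nth (bigD1 j) //= mderivXU eqxx comp_mpoly1 mul1r.
  rewrite big1 ?addr0 // => s neq_sj.
  by rewrite mderivXU eq_sym (negbTE neq_sj) comp_mpoly0 mul0r.
- rewrite comp_mpolyD mderivD IHp IHq -big_split /=; apply: eq_bigr => j _.
  by rewrite mderivD comp_mpolyD mulrDl.
- rewrite rmorphM mderivM IHp IHq mulr_suml mulr_sumr -big_split /=.
  apply: eq_bigr => j _; rewrite mderivM comp_mpolyD !rmorphM /= mulrDl.
  by rewrite mulrAC mulrA.
Qed.

Lemma comp_mpolyA (n m s : nat) (R : comNzRingType) (p : {mpoly R[n]})
    (lq : n.-tuple {mpoly R[m]}) (lr : m.-tuple {mpoly R[s]}) :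
  (p \mPo lq) \mPo lr = p \mPo [tuple tnth lq i \mPo lr | i < n].
Proof.
elim/mpoly_gen_ind: p => [c|j|p q IHp IHq|p q IHp IHq].
- by rewrite !comp_mpolyC.
- by rewrite !comp_mpolyXU -!tnth_nth tnth_mktuple.
- by rewrite !comp_mpolyD IHp IHq.
- by rewrite !rmorphM /= IHp IHq.
Qed.

Lemma mderiv_map_mpoly (n : nat) (R S : nzRingType) (f : {rmorphism R -> S})
    (i : 'I_n) (p : {mpoly R[n]}) :
  map_mpoly f p^`M(i) = (map_mpoly f p)^`M(i).
Proof.
apply/mpolyP => u.
by rewrite mcoeff_deriv !mcoeff_map_mpoly mcoeff_deriv raddfMn.
Qed.

Lemma dhomog_mderiv (n : nat) (R : nzRingType) (d : nat) (i : 'I_n)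
    (p : {mpoly R[n]}) :
  p \is d.-homog -> p^`M(i) \is d.-1.-homog.
Proof.
move=> hp; apply/dhomogP => u; rewrite mcoeff_msupp mcoeff_deriv => nz.
have nz_p : (u + U_(i))%MM \in msupp p.
  by rewrite mcoeff_msupp; apply: contra_neq nz => ->; rewrite mul0rn.
by rewrite -(dhomog_mf hp nz_p) /= mdegD mdeg1 addn1.
Qed.

Lemma dhomog_euler (n : nat) (R : comNzRingType) (d : nat) (p : {mpoly R[n]}) :
  p \is d.-homog -> \sum_(i < n) 'X_i * p^`M(i) = p *+ d.
Proof.
move=> hp; rewrite /mderiv; under eq_bigr => i _ do rewrite mulr_sumr.
rewrite exchange_big /= {3}[p]mpolyE -sumrMnl !big_seq.
apply: eq_bigr => u hu; rewrite -(dhomog_mf hp hu) /= mdegE -sumrMnr.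
apply: eq_bigr => i _; rewrite mulr_natl -scalerAr -mpolyXD.
(* The exponent [u - U_(i)] truncates when [u i = 0]; the factor [u i] then kills the term. *)
rewrite scalerMnl; have [->|nz_ui] := eqVneq (u i) 0%N.
  by rewrite !mulr0n !scale0r.
by rewrite addmC submK // lep1mP.
Qed.

(** * Divisibility by powers of a variable *)

Lemma mcoeff_mulXn (n : nat) (R : comNzRingType) (i : 'I_n) (l : nat)
    (p : {mpoly R[n]}) (u : 'X_{1..n}) :
  ('X_i ^+ l * p)@_(u + U_(i) *+ l) = p@_u.
Proof. by rewrite mpolyXn mulrC addmC mcoeffMX. Qed.

Lemma mcoeff_mulXn_lt (n : nat) (R : comNzRingType) (i : 'I_n) (l : nat)
    (p : {mpoly R[n]}) (u : 'X_{1..n}) :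
  (u i < l)%N -> ('X_i ^+ l * p)@_u = 0.
Proof.
move=> lt_ul; apply: memN_msupp_eq0; rewrite mpolyXn mulrC.
rewrite (perm_mem (msuppMX _ _)); apply/mapP => -[v _ def_u].
by move: lt_ul; rewrite def_u mnmDE mulmnE mnm1E eqxx mul1n ltnNge leq_addr.
Qed.

Lemma mulXn_exists (n : nat) (R : comNzRingType) (i : 'I_n) (l : nat)
    (p : {mpoly R[n]}) :
  (forall u : 'X_{1..n}, (u i < l)%N -> p@_u = 0) ->
  exists q, 'X_i ^+ l * q = p.
Proof.
move=> p_low.
(* Each monomial of [p] has [i]-th exponent at least [l], so the subtraction is exact on the
   support. *)
exists (\sum_(u <- msupp p) p@_u *: 'X_[u - U_(i) *+ l]).
rewrite mulr_sumr [RHS]mpolyE !big_seq; apply: eq_bigr => u.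
rewrite mcoeff_msupp => nz_pu; rewrite -scalerAr mpolyXn -mpolyXD addmC submK //.
apply/mnm_lepP => j; rewrite mulmnE mnm1E.
have [<-|_] := eqVneq i j; last by rewrite mul0n.
by rewrite mul1n leqNgt; apply: contra_neqN nz_pu => /p_low.
Qed.

(** * Derivations along a constant vector *)

Definition dderiv (n : nat) (R : nzRingType) (v : 'I_n -> R)
  (p : {mpoly R[n]}) : {mpoly R[n]} := \sum_(j < n) v j *: p^`M(j).

Lemma mderiv_dderiv (n : nat) (R : comNzRingType) (v : 'I_n -> R) (i : 'I_n)
    (p : {mpoly R[n]}) :
  (dderiv v p)^`M(i) = dderiv v p^`M(i).
Proof.
rewrite raddf_sum; apply: eq_bigr => j _.
by rewrite /= mderivZ mderiv_comm.
Qed.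

Lemma dhomog_dderiv (n : nat) (R : nzRingType) (v : 'I_n -> R) (d : nat)
    (p : {mpoly R[n]}) :
  p \is d.-homog -> dderiv v p \is d.-1.-homog.
Proof.
by move=> hp; apply: rpred_sum => j _; apply/rpredZ/dhomog_mderiv.
Qed.

Lemma dhomog_iter_dderiv (n : nat) (R : nzRingType) (v : 'I_n -> R) (d l : nat)
    (p : {mpoly R[n]}) :
  p \is d.-homog -> iter l (dderiv v) p \is (d - l).-homog.
Proof.
move=> hp; elim: l => [|l IHl]; first by rewrite subn0.
by rewrite subnS; apply: dhomog_dderiv.
Qed.

Lemma dhomog_iter_mderiv (n : nat) (R : nzRingType) (i : 'I_n) (d l : nat)
    (p : {mpoly R[n]}) :
  p \is d.-homog -> iter l (mderiv i) p \is (d - l).-homog.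
Proof.
move=> hp; elim: l => [|l IHl]; first by rewrite subn0.
by rewrite subnS; apply: dhomog_mderiv.
Qed.

Lemma sum_xz (V : nmodType) (F : 'I_2 -> V) :
  \sum_(j < 2) F j = F ix + F iz.
Proof. by rewrite big_ord_recl big_ord1; congr (_ + F _); apply: val_inj. Qed.

(* Euler's identity turns [z * d/dz] into [- x * d/dx] on forms whose degree
   vanishes in [R]. *)
Lemma iter_dderiv_eq (R : comNzRingType) (v : 'I_2 -> R) (e l : nat)
    (p : {mpoly R[2]}) :
  e%:R = 0 :> R -> p \is (e + l).-1.-homog ->
  'X_iz ^+ l * iter l (dderiv v) p =
    (v ix *: 'X_iz - v iz *: 'X_ix) ^+ l * iter l (mderiv ix) p.
Proof.
move=> e0; elim: l p => [|l IHl] p hp; first by rewrite !expr0.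
(* At this stage [p] has degree [e + l], so its [l]-th derivative has degree [e], which is zero in
   [R]. *)
have he : iter l (dderiv v) p \is e.-homog.
  rewrite -[e in e.-homog](addnK l); apply: dhomog_iter_dderiv.
  by move: hp; rewrite addnS.
have euler : 'X_iz * (iter l (dderiv v) p)^`M(iz) =
    - ('X_ix * (iter l (dderiv v) p)^`M(ix)).
  apply/eqP; rewrite -addr_eq0 addrC; move: (dhomog_euler he).
  by rewrite sum_xz -mulr_natl -mpolyC_nat e0 mpolyC0 mul0r => ->.
have comm_iter s : (iter s (dderiv v) p)^`M(ix) = iter s (dderiv v) p^`M(ix).
  by elim: s => //= s <-; rewrite mderiv_dderiv.
have step : 'X_iz * dderiv v (iter l (dderiv v) p) =
    (v ix *: 'X_iz - v iz *: 'X_ix) * iter l (dderiv v) p^`M(ix).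
  rewrite /dderiv sum_xz -/(dderiv v) mulrDr -!scalerAr euler -comm_iter.
  by rewrite mulrBl -!scalerAl scalerN.
rewrite iterS exprSr -mulrA step mulrCA IHl; last first.
  by move: (dhomog_mderiv ix hp); rewrite addnS.
by rewrite -iterSr mulrA -exprS.
Qed.

(** * Transport of iterated derivatives through ring morphisms *)

Lemma iter_intertwine (T U : Type) (f : U -> U) (g : T -> T) (h : T -> U) :
  (forall x, f (h x) = h (g x)) ->
  forall l x, iter l f (h x) = h (iter l g x).
Proof. by move=> fh l x; elim: l => //= l ->. Qed.

Lemma iter_mderiv_map_mpoly (n : nat) (R S : nzRingType)
    (f : {rmorphism R -> S}) (i : 'I_n) (l : nat) (p : {mpoly R[n]}) :
  map_mpoly f (iter l (mderiv i) p) = iter l (mderiv i) (map_mpoly f p).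
Proof.
by symmetry; apply: iter_intertwine => q; rewrite mderiv_map_mpoly.
Qed.

(** Cancellation behind the invariance criterion: [phi] will be the action on coefficients, [psi]
    the substitution of [M (x, z)], [D] and [E] the [l]-th derivatives of [Q] along [x] and along
    the first column of [M]. Multiplying [phi P = psi P] by the regular elements [z ^+ l] and
    [psi (z ^+ l)] removes the quotient. *)
Lemma eq_rmorph_divXn (S : comNzRingType) (phi psi : {rmorphism S -> S})
    (z P D E L : S) (l : nat) :
    GRing.lreg (z ^+ l) -> bijective psi -> phi z = z -> psi L = z ->
    z ^+ l * P = D -> phi D = psi E ->
  phi P = psi P <-> z ^+ l * E = L ^+ l * D.
Proof.
move=> reg_z [psi' psiK psiK'] phi_z psi_L <-.
rewrite rmorphM rmorphXn /= phi_z => phiE.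
have reg_psi : GRing.lreg (psi (z ^+ l)).
  move=> a b; rewrite -[a]psiK' -[b]psiK' -!rmorphM.
  by move/(can_inj psiK)/reg_z => ->.
have psi_eq : psi (z ^+ l * E) = psi (L ^+ l * (z ^+ l * P)) <->
    z ^+ l * (psi (z ^+ l) * phi P) = z ^+ l * (psi (z ^+ l) * psi P).
  by rewrite !rmorphM -phiE [psi (L ^+ l)]rmorphXn /= psi_L mulrCA.
split=> [phiP|/(congr1 psi)/psi_eq/reg_z/reg_psi//].
by apply: (can_inj psiK); apply/psi_eq; rewrite phiP.
Qed.

Lemma lreg_mpolyXn (n : nat) (R : comNzRingType) (i : 'I_n) (l : nat) :
  GRing.lreg ('X_i ^+ l : {mpoly R[n]}).
Proof.
move=> p q eq_pq; apply/mpolyP => u.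
by rewrite -(mcoeff_mulXn i l p) eq_pq mcoeff_mulXn.
Qed.

(** * The action of [SL_2] on forms and on their derivatives *)

Section Action.
Variables (k : fieldType) (n : nat).
Implicit Types (M N : 'M[k]_2) (p P Q : xz_ring k n).

Lemma tnth_act_xz M (i : 'I_2) :
  tnth (act_xz n M) i = \sum_(j < 2) (M i j)%:MP *: 'X_j.
Proof. by rewrite tnth_mktuple. Qed.

(** Substituting [N], then [M], amounts to substituting the product [N *m M]. *)
Lemma comp_act_xzK M N p :
  N *m M = 1%:M -> (p \mPo act_xz n N) \mPo act_xz n M = p.
Proof.
move=> NM; rewrite comp_mpolyA -[RHS]comp_mpoly_id; congr (p \mPo _).
apply: eq_from_tnth => i; rewrite !tnth_mktuple raddf_sum /=.
under eq_bigr => j _ do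
  rewrite comp_mpolyZ comp_mpolyXU -tnth_nth tnth_act_xz scaler_sumr.
have NM_ s : \sum_j N i j * M j s = (i == s)%:R.
  by have := congr1 (fun A : 'M[k]_2 => A i s) NM; rewrite !mxE.
rewrite exchange_big /= (eq_bigr (fun s => (i == s)%:R *: 'X_s)) => [|s _].
  rewrite (bigD1 i) //= eqxx scale1r big1 ?addr0 // => s neq_si.
  by rewrite eq_sym (negbTE neq_si) scale0r.
under eq_bigr => j _ do rewrite scalerA -mpolyCM.
by rewrite -scaler_suml -raddf_sum /= NM_ mpolyC_nat.
Qed.

Lemma det_eq1_unitmx M : \det M = 1 -> M \in unitmx.
Proof. by rewrite unitmxE => ->; apply: unitr1. Qed.

Lemma comp_act_xz_bij M : \det M = 1 -> bijective (comp_mpoly (act_xz n M)).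
Proof.
move=> /det_eq1_unitmx uM; exists (comp_mpoly (act_xz n (invmx M))) => p.
  exact: comp_act_xzK (mulmxV uM).
exact: comp_act_xzK (mulVmx uM).
Qed.

(** Moving [M^-1] to the other side turns invariance into the agreement of two ring morphisms at
    [P]. *)
Lemma act_form_eq M P : \det M = 1 ->
  act_form M P = P <->
  map_mpoly (comp_mpoly (act_coef n M)) P = P \mPo act_xz n M.
Proof.
move=> /det_eq1_unitmx uM; rewrite /act_form; split=> [{2}<-|->].
  by rewrite (comp_act_xzK _ (mulVmx uM)).
by rewrite (comp_act_xzK _ (mulmxV uM)).
Qed.

(** The first column of [M]: by the chain rule, the coefficients of [d/dx] in the coordinates
    [X, Z]. *)
Definition act_dir M (j : 'I_2) : coef_ring k n := (M j ix)%:MP.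

Lemma mderiv_comp_act_xz M p :
  (p \mPo act_xz n M)^`M(ix) = dderiv (act_dir M) p \mPo act_xz n M.
Proof.
rewrite mderiv_comp_mpoly raddf_sum; apply: eq_bigr => j _ /=.
rewrite comp_mpolyZ tnth_act_xz sum_xz mderivD !mderivZ !mderivXU /=.
by rewrite scaler0 addr0 -scalerAr mulr1.
Qed.

Lemma iter_mderiv_comp_act_xz M l p :
  iter l (mderiv ix) (p \mPo act_xz n M) =
    iter l (dderiv (act_dir M)) p \mPo act_xz n M.
Proof. exact/iter_intertwine/mderiv_comp_act_xz. Qed.

Lemma det2E M : \det M = M ix ix * M iz iz - M ix iz * M iz ix.
Proof.
rewrite (expand_det_row M ix) sum_xz /cofactor !det_mx11 !mxE /=.
rewrite expr0 expr1 mul1r mulN1r mulrN.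
by congr (M _ _ * M _ _ - M _ _ * M _ _); apply: val_inj.
Qed.

(** Cramer's rule: [M_00 (M_10 x + M_11 z) - M_10 (M_00 x + M_01 z) = det M z]. *)
Lemma comp_act_xz_z M : \det M = 1 ->
  (act_dir M ix *: 'X_iz - act_dir M iz *: 'X_ix) \mPo act_xz n M = 'X_iz.
Proof.
move=> detM; rewrite comp_mpolyB !comp_mpolyZ !comp_mpolyXU -!tnth_nth.
rewrite !tnth_act_xz !sum_xz !scalerDr !scalerA -!mpolyCM.
rewrite [M iz ix * M ix ix]mulrC opprD addrACA subrr add0r.
by rewrite -scalerBl -mpolyCB [M iz ix * _]mulrC -det2E detM scale1r.
Qed.

Lemma act_form_dderiv M P Q l : \det M = 1 -> act_form M Q = Q ->
    'X_iz ^+ l * P = iter l (mderiv ix) Q ->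
  act_form M P = P <->
  'X_iz ^+ l * iter l (dderiv (act_dir M)) Q =
    (act_dir M ix *: 'X_iz - act_dir M iz *: 'X_ix) ^+ l * iter l (mderiv ix) Q.
Proof.
move=> detM actQ PE; have QM := (act_form_eq Q detM).1 actQ.
apply: (iff_trans (act_form_eq P detM)).
(* The action on coefficients commutes with [d/dx]; invariance of [Q] turns it into a substitution,
   to which the chain rule applies. *)
have phi_derivE : map_mpoly (comp_mpoly (act_coef n M))
    (iter l (mderiv ix) Q) = iter l (dderiv (act_dir M)) Q \mPo act_xz n M.
  rewrite -iter_mderiv_comp_act_xz -QM.
  exact: iter_mderiv_map_mpoly.
exact: eq_rmorph_divXn (@lreg_mpolyXn _ _ _ _) (comp_act_xz_bij detM)
  (map_mpolyX _ _) (comp_act_xz_z detM) PE phi_derivE.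
Qed.

End Action.

(** * Expansion in the parameter [t] of the direction [(1, t)] *)

Lemma mderiv_hornerC (n : nat) (R : comNzRingType) (i : 'I_n)
    (A : {poly {mpoly R[n]}}) (c : R) :
  (A.[c%:MP])^`M(i) = (map_poly (mderiv i) A).[c%:MP].
Proof.
rewrite /map_poly horner_poly horner_coef raddf_sum; apply: eq_bigr => j _ /=.
by rewrite -rmorphXn /= mulrC mderiv_mulC mulrC.
Qed.

(** The partial derivatives commute, so [(d/dx + t d/dz)^l] expands binomially in [t]; the terms in
    [t^0] and [t^1] suffice for the linear comparison. *)
Lemma iter_dderiv_poly (R : comNzRingType) (p : {mpoly R[2]}) (l : nat) :
  exists A : {poly {mpoly R[2]}},
    (forall v : 'I_2 -> R, v ix = 1 ->
       iter l (dderiv v) p = A.[(v iz)%:MP]) /\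
    [/\ A`_0 = iter l (mderiv ix) p
      & A`_1 = (iter l.-1 (mderiv ix) p)^`M(iz) *+ l].
Proof.
elim: l => [|l [A [AE [A0 A1]]]].
  by exists p%:P; split=> [v _|]; rewrite ?hornerC // !coefC.
exists (map_poly (mderiv ix) A + 'X * map_poly (mderiv iz) A).
split=> [v v_x|].
  rewrite iterS AE // /dderiv sum_xz v_x scale1r !mderiv_hornerC.
  by rewrite hornerD hornerM hornerX mul_mpolyC.
rewrite !coefD !coefXM !coef_map /= A0 A1 addr0; split=> //.
(* For [l = 0] the truncated [l.-1] is harmless, its term having the factor [l]. *)
by case: l {AE A0 A1} => [|l]; rewrite ?mulr0n ?raddf0 ?add0r // raddfMn /=
  mderiv_comm -mulrSr.
Qed.

Lemma linear_exp_coef1 (S : comNzRingType) (a b : S) (l : nat) :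
  ((a%:P - 'X * b%:P) ^+ l)`_1 = - (b * a ^+ l.-1 *+ l).
Proof.
(* The linear coefficient is the constant term of the derivative. *)
rewrite -[LHS]mulr1n -coef_deriv deriv_exp coefMn coef0M.
rewrite derivB derivC derivM derivX derivC mulr0 addr0 mul1r sub0r coefN coefC.
by rewrite /= -horner_coef0 horner_exp hornerD hornerN hornerM hornerX !hornerC mul0r subr0
  mulNr mulNrn.
Qed.

(** The values of [f] are numerous enough to detect every polynomial. Stated for a map [f] so that
    it passes from [k] to the constants of polynomial rings over it. *)
Definition poly_vanish (T : Type) (R : comNzRingType) (f : T -> R) :=
  forall A : {poly R}, (forall t, A.[f t] = 0) -> A = 0.

Lemma poly_vanish_mpolyC (T : Type) (n : nat) (R : comNzRingType)
    (f : T -> R) :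
  poly_vanish f -> poly_vanish (fun t => (f t)%:MP_[n]).
Proof.
move=> vf A A0; apply/polyP => i; apply/mpolyP => u.
(* Evaluation at constants acts separately on each monomial [u], which reduces to polynomials over
   [R]. *)
have -> : A`_i@_u = (map_poly (mcoeff u) A)`_i by rewrite coef_map.
rewrite (vf (map_poly _ A)) ?coef0 ?mcoeff0 // => t.
rewrite -[RHS](mcoeff0 R u) -(A0 t) /map_poly horner_poly horner_coef raddf_sum.
by apply: eq_bigr => j _ /=; rewrite -rmorphXn /= [in RHS]mulrC mcoeffCM mulrC.
Qed.

Lemma poly_vanish_closed (k : closedFieldType) : poly_vanish (@idfun k).
Proof.
move=> A A0; apply/eqP/negPn/negP => /closed_nonrootP[t].
by rewrite /root (A0 t) eqxx.
Qed.

Lemma dderiv_identity_linear (T : Type) (R : comNzRingType) (f : T -> R)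
    (p : {mpoly R[2]}) (l : nat) :
    poly_vanish f -> (0 < l)%N ->
    (forall t (v : 'I_2 -> R), v ix = 1 -> v iz = f t ->
      'X_iz ^+ l * iter l (dderiv v) p =
        (v ix *: 'X_iz - v iz *: 'X_ix) ^+ l * iter l (mderiv ix) p) ->
  ('X_ix * (iter l.-1 (mderiv ix) p)^`M(ix) +
   'X_iz * (iter l.-1 (mderiv ix) p)^`M(iz)) *+ l = 0.
Proof.
move=> vf; case: l => // l _ pE; have [A [AE [A0 A1]]] := iter_dderiv_poly p l.+1.
(* The difference of the two sides, with [v ix = 1] and [v iz] replaced by the variable ['X]. *)
pose B : {poly {mpoly R[2]}} := ('X_iz ^+ l.+1)%:P * A -
  (('X_iz)%:P - 'X * ('X_ix)%:P) ^+ l.+1 * (iter l.+1 (mderiv ix) p)%:P.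
have B0 : B = 0.
  apply: (poly_vanish_mpolyC vf) => t.
  pose v (j : 'I_2) : R := if j == ix then 1 else f t.
  have /eqP := pE t v erefl erefl; rewrite AE // -subr_eq0 => /eqP.
  rewrite /B hornerD hornerN !hornerM horner_exp hornerD hornerN hornerM hornerX.
  by rewrite !hornerC /v /= scale1r mul_mpolyC.
have := congr1 (fun C : {poly _} => C`_1) B0.
rewrite coefB coefCM coefMC linear_exp_coef1 A1 coef0 [l.+1.-1]/= => eq0.
(* The linear coefficient of [B] is [z^l] times the claim, [l] being now the predecessor of the
   original exponent. *)
apply: (@lreg_mpolyXn _ R iz l); rewrite mulr0 -[RHS]eq0.
rewrite mulrnDl mulrDr -!mulrnAr exprSr !mulrnAr mulNr opprK mulrnAl.
by rewrite addrC; congr (_ + _); rewrite -?mulrA //; congr (_ *+ _); ring.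
Qed.

(** * The quotient by [z^l]: polynomiality, order and degree *)

Lemma tofrac_divXnE (R : idomainType) (n : nat) (i : 'I_n) (l : nat)
    (p q : {mpoly R[n]}) :
  tofrac p / tofrac 'X_i ^+ l = tofrac q <-> 'X_i ^+ l * q = p.
Proof.
have nzX : tofrac ('X_i ^+ l : {mpoly R[n]}) != 0.
  by rewrite tofrac_eq0 expf_neq0 // -msupp_eq0 msuppX.
rewrite -tofracXn; split=> [pq|<-]; last first.
  by rewrite tofracM mulrAC mulfV // mul1r.
by apply/eqP; rewrite -tofrac_eq tofracM -pq mulrCA mulfV // mulr1.
Qed.

Lemma natr_coef_ring_eq0 (k : fieldType) (n e : nat) :
  e%:R = 0 :> k -> e%:R = 0 :> coef_ring k n.
Proof. by move=> e0; rewrite -mpolyC_nat e0 mpolyC0. Qed.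

Lemma mulrn_mpoly_eq0 (k : fieldType) (n m e : nat)
    (p : {mpoly (coef_ring k n)[m]}) :
  e%:R != 0 :> k -> p *+ e = 0 -> p = 0.
Proof.
move=> nz_e pe0; apply/mpolyP => u; apply/mpolyP => v.
have := congr1 (fun q : {mpoly (coef_ring k n)[m]} => q@_u@_v) pe0.
rewrite !mcoeffMn !mcoeff0 -mulr_natr => /eqP.
by rewrite mulf_eq0 (negbTE nz_e) orbF => /eqP.
Qed.

Lemma dhomog_coef_iter_mderiv (k : fieldType) (n d l : nat) (Q : xz_ring k n) :
  (forall u : 'X_{1..2}, Q@_u \is d.-homog) ->
  forall u : 'X_{1..2}, (iter l (mderiv ix) Q)@_u \is d.-homog.
Proof.
move=> hQ; elim: l => [|l IHl] u; first exact: hQ.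
by rewrite iterS mcoeff_deriv rpredMn.
Qed.

Section Quotient.
Variables (k : fieldType) (n d0 m0 l : nat) (P Q : xz_ring k n).
Hypotheses (hQ : is_covariant d0 m0 Q)
  (PE : 'X_iz ^+ l * P = iter l (mderiv ix) Q).

Lemma quotient_dhomog : P \is (m0 - 2 * l).-homog.
Proof.
have [hQm _ _] := hQ; apply/dhomogP => u; rewrite mcoeff_msupp => nz_u.
have uD : (u + U_(iz) *+ l)%MM \in msupp (iter l (mderiv ix) Q).
  by rewrite -PE mcoeff_msupp mcoeff_mulXn.
have := dhomog_mf (dhomog_iter_mderiv ix l hQm) uD.
by rewrite /= mdegD mdegMn mdeg1; lia.
Qed.

Lemma quotient_coef_dhomog (u : 'X_{1..2}) : P@_u \is d0.-homog.
Proof.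
have [_ hQd _] := hQ; rewrite -(mcoeff_mulXn iz l) PE.
exact: dhomog_coef_iter_mderiv.
Qed.

Lemma quotient_covariant (d m : nat) :
  is_covariant d m P -> is_covariant d0 (m0 - 2 * l) P.
Proof.
by case=> _ _ actP; split=> //; [exact: quotient_dhomog | exact: quotient_coef_dhomog].
Qed.

Lemma quotient_uniq (d m : nat) :
  P != 0 -> is_covariant d m P -> d = d0 /\ m = (m0 - 2 * l)%N.
Proof.
move=> nzP [hm hd _]; split; last exact: dhomog_uniq nzP hm quotient_dhomog.
have [u nz_u] : exists u : 'X_{1..2}, P@_u != 0.
  case: (msupp P) (msupp_eq0 P) (mcoeff_msupp P) => [|u s] eP suppP.
    by rewrite (negbTE nzP) in eP.
  by exists u; rewrite -suppP mem_head.
exact: dhomog_uniq nz_u (hd u) (quotient_coef_dhomog u).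
Qed.

End Quotient.

(** * The two implications *)

Lemma quotient_exists (k : fieldType) (n d0 m0 l : nat) (Q : xz_ring k n) :
    is_covariant d0 m0 Q -> (l <= m0)%N -> (m0 - l + 1)%:R = 0 :> k ->
  exists2 P : xz_ring k n, 'X_iz ^+ l * P = iter l (mderiv ix) Q
    & is_covariant d0 (m0 - 2 * l) P.
Proof.
move=> hQ le_lm /(natr_coef_ring_eq0 n) e0; have [hQm _ actQ] := hQ.
have hQe : Q \is (m0 - l + 1 + l).-1.-homog.
  by have -> : ((m0 - l + 1 + l).-1 = m0)%N by lia.
have [P PE] : exists P, 'X_iz ^+ l * P = iter l (mderiv ix) Q.
  apply: mulXn_exists => u lt_ul.
  (* For this direction the linear form is [x], so [x^l d^l Q / dx^l] is a multiple of [z^l]; the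
     factor [x^l] leaves exponents of [z] unchanged. *)
  pose v (j : 'I_2) : coef_ring k n := if j == ix then 0 else -1.
  rewrite -(mcoeff_mulXn ix l).
  have -> : 'X_ix ^+ l * iter l (mderiv ix) Q = 'X_iz ^+ l * iter l (dderiv v) Q.
    by rewrite (iter_dderiv_eq _ e0 hQe) /v /= scale0r scaleN1r opprK add0r.
  apply: mcoeff_mulXn_lt; rewrite mnmDE mulmnE mnm1E mul0n addn0.
  exact: lt_ul.
exists P => //; split; first exact: quotient_dhomog hQ PE.
  exact: quotient_coef_dhomog hQ PE.
move=> M detM; apply/(act_form_dderiv detM (actQ M detM) PE).
exact: iter_dderiv_eq e0 hQe.
Qed.

Lemma quotient_congr (k : closedFieldType) (n d0 m0 d m l : nat)
    (P Q : xz_ring k n) :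
    is_covariant d0 m0 Q -> is_covariant d m P ->
    'X_iz ^+ l * P = iter l (mderiv ix) Q -> P != 0 ->
    (0 < l <= m0)%N -> l%:R != 0 :> k ->
  (m0 - l + 1)%:R = 0 :> k.
Proof.
move=> [hQm _ actQ] [_ _ actP] PE nzP /andP[l_gt0 le_lm] nz_l.
have vC : poly_vanish (fun t : k => t%:MP_[n.+1]).
  exact: poly_vanish_mpolyC (@poly_vanish_closed k).
have /mulrn_mpoly_eq0 -/(_ nz_l) :
    ('X_ix * (iter l.-1 (mderiv ix) Q)^`M(ix) +
     'X_iz * (iter l.-1 (mderiv ix) Q)^`M(iz)) *+ l = 0.
  apply: (dderiv_identity_linear vC l_gt0) => t v v_x v_z.
  (* Lower unitriangular with first column [(1, t)]. *)
  pose M : 'M[k]_2 := \matrix_(i, j)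
    (if i == ix then (j == ix)%:R else if j == ix then t else 1).
  have detM : \det M = 1.
    by rewrite det2E !mxE /= mulr1 mul0r subr0.
  have dE : dderiv v =1 dderiv (act_dir n M).
    by move=> q; rewrite /dderiv !sum_xz v_x v_z /act_dir !mxE /=.
  rewrite (eq_iter dE) v_x v_z.
  have := (act_form_dderiv detM (actQ M detM) PE).1 (actP M detM).
  by rewrite {2 3}/act_dir !mxE /=.
have := dhomog_euler (dhomog_iter_mderiv ix l.-1 hQm).
rewrite sum_xz => -> De0.
(* If [m0 - l + 1] were non-zero in [k], the derivative of order [l.-1] would vanish, hence so would
   the next one and [P]. *)
apply: contraNeq nzP => nz_e.
have D0 : iter l.-1 (mderiv ix) Q = 0.
  apply: mulrn_mpoly_eq0 De0.
  by have -> : (m0 - l.-1 = m0 - l + 1)%N by lia.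
apply/eqP/(@lreg_mpolyXn _ _ iz l); rewrite mulr0 PE.
by case: (l) l_gt0 D0 => // s _ /= ->; rewrite mderiv0.
Qed.

Theorem theorem3 (k : closedFieldType) (p : nat) (hp : p \in [pchar k])
    (n m0 d0 : nat) (w0 : int) (Q : xz_ring k n)
    (hQ : is_covariant d0 m0 Q) (hw : has_weight d0 m0 w0 Q)
    (l : nat) (l_gt0 : (0 < l)%N) (hl : (2 * l <= m0)%N) (hlp : (l < p)%N) :
  let C : {fraction (xz_ring k n)} :=
    tofrac (Q^`M(ix, l)) / tofrac 'X_iz ^+ l in
  [/\ (m0 - l + 1 = 0 %[mod p])%N -> frac_covariant C,
      C <> 0 -> (frac_covariant C <-> (m0 - l + 1 = 0 %[mod p])%N)
    & C <> 0 -> frac_covariant C ->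
        frac_covariant_of d0 (m0 - 2 * l) C /\
        forall d m : nat, frac_covariant_of d m C -> d = d0 /\ m = (m0 - 2 * l)%N].
Proof.
move=> C.
have le_lm : (l <= m0)%N by lia.
have CE (P : xz_ring k n) :
    C = tofrac P <-> 'X_iz ^+ l * P = iter l (mderiv ix) Q.
  by rewrite -mderivn_iter; exact: tofrac_divXnE.
have modE : (m0 - l + 1 = 0 %[mod p])%N <-> (m0 - l + 1)%:R = 0 :> k.
  rewrite mod0n; split=> /eqP.
    by rewrite -/(dvdn _ _) (dvdn_pcharf hp) => /eqP.
  by rewrite -(dvdn_pcharf hp) => /eqP.
(* Because [0 < l < p], the factor [l] from the linear coefficient can be cancelled. *)
have nz_l : l%:R != 0 :> k.
  by rewrite -(dvdn_pcharf hp); apply/negP => /dvdn_leq; lia.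
have suff_mod : (m0 - l + 1 = 0 %[mod p])%N -> frac_covariant C.
  move=> /modE/(quotient_exists hQ le_lm)[P PE hP].
  by exists d0, (m0 - 2 * l)%N; exists P => //; apply/CE.
(* Zero is a covariant whatever the congruence, so the converse and the uniqueness of degree and
   order start from a non-zero [P]. *)
have nzP (P : xz_ring k n) : C <> 0 -> C = tofrac P -> P != 0.
  by move=> nzC CP; apply/eqP => P0; apply: nzC; rewrite CP P0 tofrac0.
split=> // [nzC|nzC [d [m [P CP hP]]]].
  split=> // -[d [m [P CP hP]]]; apply/modE.
  apply: (quotient_congr hQ hP ((CE P).1 CP) (nzP P nzC CP)) => //.
  by rewrite l_gt0.
split=> [|d' m' [P' CP' hP']].
  by exists P => //; apply: quotient_covariant hQ ((CE P).1 CP) _ _ hP.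
exact: quotient_uniq hQ ((CE P').1 CP') _ _ (nzP P' nzC CP') hP'.
Qed.
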